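(* Let $\mathcal{X}$ be a semi-abelian category, $n\geq1$, $Z$ an object and $A$ an abelian object of $\mathcal{X}$, and let $(\mathbb{T},\mathbb{t})$ be an $n$-torsor of $Z$ by $A$. Then the underlying $n$-cubic extension of $(\mathbb{T},\mathbb{t})$ is H-central: for all $I\subseteq n=\{0,\dots,n-1\}$, $$\Bigl[\bigcap_{i\in I}\mathrm{Ker}(\partial_{i}),\bigcap_{i\in n\setminus I}\mathrm{Ker}(\partial_{i})\Bigr]=0,$$ where the $\partial_i\colon\mathbb{T}_{n-1}\to\mathbb{T}_{n-2}$, $i\in n$, are the face operators.
   Context: A semi-abelian category is a pointed, Barr-exact, Bourn-protomodular category with binary coproducts. $[K,L]$ denotes the Huq commutator of normal subobjects $K,L$ of an object $X$ (the smallest normal subobject of $X$ such that $K$ and $L$ commute in the quotient; so $[K,L]=0$ iff there is a morphism $K\times L\to X$ restricting to the two inclusions). An object $A$ is abelian if $[A,A]=0$. An empty intersection of subobjects of $\mathbb{T}_{n-1}$ is $\mathbb{T}_{n-1}$. An $n$-cubic extension $F$ (with initial arrows $f_i\colon F_n\to F_{n\setminus\{i\}}$) is H-central when $[\bigcap_{i\in I}\mathrm{Ker}(f_i),\bigcap_{i\in n\setminus I}\mathrm{Ker}(f_i)]=0$ for all $I\subseteq n$. The $n$-cubic extension underlying $\mathbb{T}$ is the $n$-cube $I\mapsto\mathbb{T}_{|I|-1}$ ($I\subseteq n$), with initial object $\mathbb{T}_{n-1}$ and initial arrows the faces $\partial_i$. For an augmented simplicial object $\mathbb{X}$ (objects $\mathbb{X}_k$,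 $k\ge-1$), $\triangle(\mathbb{X},0)=\mathbb{X}_{-1}$ and, for $k\ge1$, $\triangle(\mathbb{X},k)$ is the object of $(x_0,\dots,x_k)\in\mathbb{X}_{k-1}^{k+1}$ with $\partial_ix_j=\partial_{j-1}x_i$ for $i<j$; $\wedge^i(\mathbb{X},k)$ is the object of families $(x_j)_{j\ne i}$, $0\le j\le k$, satisfying the same equations for indices different from $i$, with $\wedge^0(\mathbb{X},1)=\wedge^1(\mathbb{X},1)=\mathbb{X}_0$. $\mathbb{X}$ is a resolution if $\mathbb{X}_k\to\triangle(\mathbb{X},k)$ is a regular epimorphism for all $k\ge0$. A simplicial morphism $\mathbb{X}\to\mathbb{Y}$ is a fibration if $\mathbb{X}_k\to\wedge^i(\mathbb{X},k)\times_{\wedge^i(\mathbb{Y},k)}\mathbb{Y}_k$ is a regular epimorphism for all $k\ge1$ and all $i$; it is exact in degree $k$ if these are isomorphisms for all $i$. $\mathrm{Cosk}_{n-1}$ is the $(n-1)$-coskeleton of the $(n-1)$-truncation. $\mathbb{K}(Z,A,n)$ is the coskeleton of the $(n+1)$-truncated augmented simplicial object with $Z$ in degrees $-1,\dots,n-1$ (identity faces), $A\times Z$ in degree $n$ (all faces $\mathrm{pr}_Z$, degeneracies $\langle0,1_Z\rangle$ from degree $n-1$), and $A^{n+1}\times Z$ in degree $n+1$ with faces $\mathrm{pr}_0\times1_Z,\dots,\mathrm{pr}_n\times1_Z$ and $\partial_{n+1}\times1_Z$, $\partial_{n+1}=(-1)^n\sum_{i=0}^n(-1)^i\mathrm{pr}_i$.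 An $n$-torsor of $Z$ by $A$ is an augmented simplicial object $\mathbb{T}$ with $\mathbb{T}_{-1}=Z$ and a simplicial morphism $\mathbb{t}\colon\mathbb{T}\to\mathbb{K}(Z,A,n)$ with $\mathbb{t}_{-1}=1_Z$ such that (T1) $\mathbb{t}$ is a fibration which is exact in all degrees $\ge n$; (T2) $\mathbb{T}\cong\mathrm{Cosk}_{n-1}\mathbb{T}$; (T3) $\mathbb{T}$ is a resolution. *)

(* Defs.v *)
From mathcomp Require Import all_boot.
Set Implicit Arguments.
Unset Strict Implicit.
Unset Printing Implicit Defensive.

Record category := Category {
  ob :> Type;
  hom : ob -> ob -> Type;
  idm : forall X, hom X X;
  comp : forall X Y V, hom Y V -> hom X Y -> hom X V;
  compA : forall X Y V W (h : hom V W) (g : hom Y V) (f : hom X Y),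
    comp h (comp g f) = comp (comp h g) f;
  comp1m : forall X Y (f : hom X Y), comp (idm Y) f = f;
  compm1 : forall X Y (f : hom X Y), comp f (idm X) = f
}.
Arguments hom {c} X Y.
Arguments idm {c} X.
Arguments comp {c X Y V} g f.
Notation "g \oc f" := (comp g f) (at level 40, left associativity).

Section Categories.
Variable C : category.
Implicit Types X Y V W : C.

Definition is_iso X Y (f : hom X Y) :=
  exists g : hom Y X, g \oc f = idm X /\ f \oc g = idm Y.

Record diagram := Diagram {
  vert : finType;
  edge : finType;
  src : edge -> vert;
  tgt : edge -> vert;
  dob : vert -> C;
  darr : forall e, hom (dob (src e)) (dob (tgt e))
}.

Definition is_cone (D : diagram) W (p : forall v, hom W (dob (d := D) v)) :=
  forall e, darr e \oc p (src e) = p (tgt e).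

Definition is_limit (D : diagram) L (p : forall v, hom L (dob (d := D) v)) :=
  is_cone p /\
  forall W (q : forall v, hom W (dob v)), is_cone q ->
    exists! u : hom W L, forall v, p v \oc u = q v.

(* Limits of finite graphs, equivalently of finite categories. *)
Definition finitely_complete := forall D : diagram,
  exists L (p : forall v, hom L (dob (d := D) v)), is_limit p.

Definition is_pullback X Y B P (f : hom X B) (g : hom Y B)
    (p : hom P X) (q : hom P Y) :=
  f \oc p = g \oc q /\
  forall W (x : hom W X) (y : hom W Y), f \oc x = g \oc y ->
    exists! u : hom W P, p \oc u = x /\ q \oc u = y.

Definition is_product X Y P (p : hom P X) (q : hom P Y) :=
  forall W (x : hom W X) (y : hom W Y),
    exists! u : hom W P, p \oc u = x /\ q \oc u = y.

Definition is_coproduct X Y S (i : hom X S) (j : hom Y S) :=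
  forall W (x : hom X W) (y : hom Y W),
    exists! u : hom S W, u \oc i = x /\ u \oc j = y.

Definition is_coequalizer X Y Q (f g : hom X Y) (q : hom Y Q) :=
  q \oc f = q \oc g /\
  forall W (h : hom Y W), h \oc f = h \oc g ->
    exists! u : hom Q W, u \oc q = h.

Definition regular_epi X Y (f : hom X Y) :=
  exists R (d0 d1 : hom R X), is_coequalizer d0 d1 f.

Definition is_kernel_pair X Y R (f : hom X Y) (d0 d1 : hom R X) :=
  is_pullback f f d0 d1.

Definition is_zero_object O :=
  (forall X, exists! u : hom X O, True) /\ (forall X, exists! u : hom O X, True).

Definition is_zero X Y (f : hom X Y) :=
  exists O (g : hom X O) (h : hom O Y), is_zero_object O /\ f = h \oc g.

Definition is_kernel X Y K (f : hom X Y) (k : hom K X) :=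
  is_zero (f \oc k) /\
  forall W (w : hom W X), is_zero (f \oc w) -> exists! u : hom W K, k \oc u = w.

Definition is_cokernel X Y Q (f : hom X Y) (q : hom Y Q) :=
  is_zero (q \oc f) /\
  forall W (w : hom Y W), is_zero (w \oc f) -> exists! u : hom Q W, u \oc q = w.

Definition pointed := exists O, is_zero_object O.

Definition regular_category :=
  [/\ finitely_complete,
      forall X Y (f : hom X Y) R (d0 d1 : hom R X), is_kernel_pair f d0 d1 ->
        exists Q (q : hom X Q), is_coequalizer d0 d1 q
    & forall X Y B P (f : hom X B) (g : hom Y B) (p : hom P X) (q : hom P Y),
        is_pullback f g p q -> regular_epi f -> regular_epi q].

(* The generalised elements W -> X that the span (d0, d1) relates. *)
Definition related R X (d0 d1 : hom R X) W (x y : hom W X) :=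
  exists r : hom W R, d0 \oc r = x /\ d1 \oc r = y.

Definition equivalence_relation R X (d0 d1 : hom R X) :=
  [/\ forall W (r s : hom W R),
        d0 \oc r = d0 \oc s -> d1 \oc r = d1 \oc s -> r = s,
      forall W (x : hom W X), related d0 d1 x x,
      forall W (x y : hom W X), related d0 d1 x y -> related d0 d1 y x
    & forall W (x y z : hom W X),
        related d0 d1 x y -> related d0 d1 y z -> related d0 d1 x z].

Definition Barr_exact :=
  regular_category /\
  forall R X (d0 d1 : hom R X), equivalence_relation d0 d1 ->
    exists Y (f : hom X Y), is_kernel_pair f d0 d1.

(* Every change-of-base functor v^* from points over B to points over B'
   reflects isomorphisms; h' is v^* applied to the map of points h.  The
   section of the pulled-back point plays no role in h' being invertible. *)
Definition protomodular :=
  finitely_complete /\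
  forall B' B (v : hom B' B)
    A1 (f1 : hom A1 B) (s1 : hom B A1) A2 (f2 : hom A2 B) (s2 : hom B A2)
    (h : hom A1 A2),
    f1 \oc s1 = idm B -> f2 \oc s2 = idm B ->
    f2 \oc h = f1 -> h \oc s1 = s2 ->
  forall P1 (a1 : hom P1 A1) (b1 : hom P1 B') P2 (a2 : hom P2 A2) (b2 : hom P2 B')
    (h' : hom P1 P2),
    is_pullback f1 v a1 b1 -> is_pullback f2 v a2 b2 ->
    a2 \oc h' = h \oc a1 -> b2 \oc h' = b1 ->
    is_iso h' -> is_iso h.

Definition binary_coproducts := forall X Y,
  exists S (i : hom X S) (j : hom Y S), is_coproduct i j.

Definition semi_abelian :=
  [/\ pointed, Barr_exact, protomodular & binary_coproducts].

Definition is_normal K X (k : hom K X) := exists Y (f : hom X Y), is_kernel f k.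

Definition subobject_le M N X (m : hom M X) (m' : hom N X) :=
  exists u : hom M N, m = m' \oc u.

(* A morphism K x L -> X restricting to k and l along <1,0> and <0,1>. *)
Definition Huq_commute K L X (k : hom K X) (l : hom L X) :=
  exists P (p : hom P K) (q : hom P L) (i : hom K P) (j : hom L P) (phi : hom P X),
    [/\ is_product p q,
        p \oc i = idm K /\ is_zero (q \oc i),
        is_zero (p \oc j) /\ q \oc j = idm L
      & phi \oc i = k /\ phi \oc j = l].

Definition commute_modulo K L N X (k : hom K X) (l : hom L X) (c : hom N X) :=
  exists Q (q : hom X Q), is_cokernel c q /\ Huq_commute (q \oc k) (q \oc l).

Definition is_Huq_commutator K L N X (k : hom K X) (l : hom L X) (c : hom N X) :=
  [/\ is_normal c, commute_modulo k l c
    & forall N' (c' : hom N' X),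
        is_normal c' -> commute_modulo k l c' -> subobject_le c c'].

(* [K,L] = 0 *)
Definition Huq_commutator_trivial K L X (k : hom K X) (l : hom L X) :=
  exists O (o : hom O X), is_zero_object O /\ is_Huq_commutator k l o.

Definition abelian A := Huq_commutator_trivial (idm A) (idm A).

(* Internal abelian group structures, as natural abelian group structures on
   the sets hom W A (Yoneda).  In a semi-abelian category, an abelian object
   carries exactly one of them. *)
Record abelian_group_structure A := AbelianGroupStructure {
  agadd : forall W, hom W A -> hom W A -> hom W A;
  agzero : forall W, hom W A;
  agopp : forall W, hom W A -> hom W A;
  agaddA : forall W, associative (@agadd W);
  agaddC : forall W, commutative (@agadd W);
  agadd0 : forall W, left_id (agzero W) (@agadd W);
  agaddN : forall W, left_inverse (agzero W) (@agopp W) (@agadd W);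
  agadd_nat : forall W V (f : hom V W) (x y : hom W A),
    agadd x y \oc f = agadd (x \oc f) (y \oc f)
}.

(* (-1)^n \sum_(i <= n) (-1)^i x_i *)
Definition alternating_sum A (G : abelian_group_structure A) W n
    (x : 'I_n.+1 -> hom W A) : hom W A :=
  iter n (agopp G (W := W))
    (\big[agadd G (W := W)/agzero G W]_(i < n.+1) iter i (agopp G (W := W)) (x i)).

(* k is the intersection of the subobjects m i, i \in I; for empty I this makes
   k an isomorphism. *)
Definition is_intersection n X (M : 'I_n -> C) (m : forall i, hom (M i) X)
    (I : {set 'I_n}) K (k : hom K X) :=
  (forall i, i \in I -> subobject_le k (m i)) /\
  forall W (w : hom W X), (forall i, i \in I -> subobject_le w (m i)) ->
    exists! u : hom W K, k \oc u = w.

(* H-centrality of an n-cubic extension depends only on its initial arrows f i. *)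
Definition H_central n X (Y : 'I_n -> C) (f : forall i, hom X (Y i)) :=
  forall (M : 'I_n -> C) (m : forall i, hom (M i) X),
    (forall i, is_kernel (f i) (m i)) ->
  forall (I : {set 'I_n}) K (k : hom K X) L (l : hom L X),
    is_intersection m I k -> is_intersection m (~: I) l ->
    Huq_commutator_trivial k l.

End Categories.

Record delta (m n : nat) := Delta {
  dfun :> {ffun 'I_m -> 'I_n};
  _ : [forall i : 'I_m, forall j : 'I_m, (i <= j) ==> (dfun i <= dfun j)]
}.

Lemma delta_ext m n (f g : delta m n) : f =1 g -> f = g.
Proof.
case: f g => [f Hf] [g Hg] /= /ffunP E; case: _ / E Hg => Hg.
by rewrite (bool_irrelevance Hf Hg).
Qed.

Lemma delta_mono m n (f : delta m n) (i j : 'I_m) : i <= j -> f i <= f j.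
Proof. by case: f => f /= /forallP/(_ i)/forallP/(_ j)/implyP; apply. Qed.

Lemma monoP m n (f : 'I_m -> 'I_n) : (forall i j : 'I_m, i <= j -> f i <= f j) ->
  [forall i : 'I_m, forall j : 'I_m, (i <= j) ==> ([ffun x => f x] i <= [ffun x => f x] j)].
Proof.
by move=> H; apply/forallP=> i; apply/forallP=> j; apply/implyP=> /H; rewrite !ffunE.
Qed.

Definition mkdelta m n (f : 'I_m -> 'I_n)
  (H : forall i j : 'I_m, i <= j -> f i <= f j) : delta m n := Delta (monoP H).

Lemma mkdeltaE m n (f : 'I_m -> 'I_n) H x : @mkdelta m n f H x = f x.
Proof. by rewrite ffunE. Qed.

Definition delta_id n : delta n n := @mkdelta n n id (fun _ _ H => H).

Definition delta_comp m n p (g : delta n p) (f : delta m n) : delta m p :=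
  @mkdelta m p (fun i => g (f i)) (fun _ _ H => delta_mono g (delta_mono f H)).

Definition delta_empty n : delta 0 n :=
  @mkdelta 0 n (widen_ord (leq0n n)) (fun _ _ H => H).

Lemma coface_mono n (i : 'I_n) (j k : 'I_n.-1) : j <= k -> lift i j <= lift i k.
Proof. by rewrite /= leq_bump2. Qed.

Definition coface n (i : 'I_n) : delta n.-1 n := mkdelta (@coface_mono n i).

Lemma unbump_lt n (i : 'I_n) (j : 'I_n.+1) : unbump i j < n.
Proof.
rewrite /unbump; case: (ltnP i j) => /= ij.
  by rewrite subn1 -ltnS prednK ?(leq_ltn_trans _ ij).
by rewrite subn0 (leq_ltn_trans ij).
Qed.

Lemma codegen_mono n (i : 'I_n) (j k : 'I_n.+1) : j <= k ->
  Ordinal (unbump_lt i j) <= Ordinal (unbump_lt i k).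
Proof.
rewrite /= /unbump => jk; case: (ltnP i j) => /= ij.
  by rewrite (leq_trans ij jk) leq_sub2r.
case: (ltnP i k) => /= ik; rewrite ?subn0 ?subn1 //.
by rewrite -ltnS prednK ?(leq_ltn_trans _ ik) // (leq_ltn_trans ij).
Qed.

Definition codegen n (i : 'I_n) : delta n.+1 n := mkdelta (@codegen_mono n i).

(* Degrees are shifted by one: sob X m is the object of degree m - 1, so that
   sob X 0 is the object of degree -1. *)
Record asimp (C : category) := ASimp {
  sob :> nat -> C;
  smap : forall m n, delta m n -> hom (sob n) (sob m);
  smap_id : forall n, smap (delta_id n) = idm (sob n);
  smap_comp : forall m n p (g : delta n p) (f : delta m n),
    smap (delta_comp g f) = smap f \oc smap g
}.

Record smorph (C : category) (X Y : asimp C) := SMorph {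
  scomp :> forall m, hom (X m) (Y m);
  scomp_nat : forall m n (f : delta m n),
    smap Y f \oc scomp n = scomp m \oc smap X f
}.

Section Simplicial.
Variable C : category.
Implicit Types X Y : asimp C.

(* For n = k + 1 this is the face d_i from degree k to degree k - 1. *)
Definition face X n (i : 'I_n) : hom (X n) (X n.-1) := smap X (coface i).

(* For n = k + 1 this is the degeneracy s_i from degree k to degree k + 1. *)
Definition degen X n (i : 'I_n) : hom (X n) (X n.+1) := smap X (codegen i).

(* The composite of faces down to degree -1. *)
Definition augmentation X n : hom (X n) (X 0) := smap X (delta_empty n).

(* X is the coskeleton of its truncation to the degrees < N: the identity of
   that truncation exhibits X as the value there of the right adjoint of
   truncation. *)
Definition coskeletal (N : nat) X :=
  forall Y (f : forall m, m <= N -> hom (Y m) (X m)),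
    (forall m n (a : delta m n) (hm : m <= N) (hn : n <= N),
       smap X a \oc f n hn = f m hm \oc smap Y a) ->
  exists g : smorph Y X, (forall m (hm : m <= N), g m = f m hm) /\
    forall g' : smorph Y X, (forall m (hm : m <= N), g' m = f m hm) ->
      forall m, g' m = g m.

(* In the next definitions k = m + 1 is the degree: the entries x j live in
   degree k - 1 = m and the equations in degree k - 2. *)
Definition simplicial_equation X m W (x : 'I_m.+2 -> hom W (X m.+1)) (i j : 'I_m.+2) :=
  i < j -> face X (inord i : 'I_m.+1) \oc x j = face X (inord j.-1 : 'I_m.+1) \oc x i.

Definition is_simplicial_kernel X m D (p : 'I_m.+2 -> hom D (X m.+1)) :=
  (forall i j, simplicial_equation p i j) /\
  forall W (x : 'I_m.+2 -> hom W (X m.+1)), (forall i j, simplicial_equation x i j) ->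
    exists! u : hom W D, forall j, p j \oc u = x j.

Definition is_resolution X :=
  regular_epi (face X (ord0 : 'I_1)) /\
  forall m, exists D (p : 'I_m.+2 -> hom D (X m.+1)) (c : hom (X m.+2) D),
    [/\ is_simplicial_kernel p, forall j, p j \oc c = face X j & regular_epi c].

Definition horn_index m (i : 'I_m.+2) := {j : 'I_m.+2 | j != i}.

Definition horn_equations X m (i : 'I_m.+2) W (x : horn_index i -> hom W (X m.+1)) :=
  forall a b : horn_index i, val a < val b ->
    face X (inord (val a) : 'I_m.+1) \oc x b
    = face X (inord (val b).-1 : 'I_m.+1) \oc x a.

Definition is_horn_object X m (i : 'I_m.+2) H (p : horn_index i -> hom H (X m.+1)) :=
  horn_equations p /\
  forall W (x : horn_index i -> hom W (X m.+1)), horn_equations x ->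
    exists! u : hom W H, forall j, p j \oc u = x j.

(* c is the comparison morphism
     X_k -> /\^i(X,k) x_{/\^i(Y,k)} Y_k = P   (k = m + 1) induced by f. *)
Definition is_horn_comparison X Y (f : smorph X Y) m (i : 'I_m.+2) P
    (c : hom (X m.+2) P) :=
  exists HX (p : horn_index i -> hom HX (X m.+1))
         HY (q : horn_index i -> hom HY (Y m.+1))
         (fH : hom HX HY) (h : hom (Y m.+2) HY) (a : hom P HX) (b : hom P (Y m.+2)),
    [/\ is_horn_object p /\ is_horn_object q,
        forall j, q j \oc fH = f m.+1 \oc p j,
        forall j, q j \oc h = face Y (val j),
        is_pullback fH h a b
      & (forall j, p j \oc (a \oc c) = face X (val j)) /\ b \oc c = f m.+2].

Definition fibration X Y (f : smorph X Y) :=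
  forall m (i : 'I_m.+2), exists P (c : hom (X m.+2) P),
    is_horn_comparison f i c /\ regular_epi c.

Definition exact_in_degree X Y (f : smorph X Y) (k : nat) :=
  forall m (i : 'I_m.+2), m.+1 = k -> exists P (c : hom (X m.+2) P),
    is_horn_comparison f i c /\ is_iso c.

(* The simplicial object K(Z,A,n), up to isomorphism.  KZA_base identifies the
   object of degree -1 with Z; its composites with the augmentations are the
   projections to Z, so that the Z-components of all structure maps are
   automatically as required. *)
Record KZA (Z A : C) (n : nat) := MkKZA {
  KZA_obj :> asimp C;
  KZA_group : abelian_group_structure A;
  KZA_base : hom (KZA_obj 0) Z;
  KZA_coef : hom (KZA_obj n.+1) A;
  (* Z in the degrees -1, ..., n - 1 *)
  KZA_base_iso : is_iso KZA_base;
  KZA_low : forall m, m <= n -> is_iso (augmentation KZA_obj m);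
  (* A x Z in degree n, with degeneracies <0, 1_Z> from degree n - 1 *)
  KZA_top : is_product KZA_coef (KZA_base \oc augmentation KZA_obj n.+1);
  KZA_degen : forall i : 'I_n, is_zero (KZA_coef \oc degen KZA_obj i);
  (* A^(n+1) x Z in degree n + 1: the projections to A are the A-components of
     the first n + 1 faces *)
  KZA_next : forall W (x : 'I_n.+1 -> hom W A) (z : hom W Z),
    exists! u : hom W (KZA_obj n.+2),
      (forall i : 'I_n.+1,
         KZA_coef \oc face KZA_obj (widen_ord (leqnSn n.+1) i) \oc u = x i) /\
      KZA_base \oc augmentation KZA_obj n.+2 \oc u = z;
  KZA_last : KZA_coef \oc face KZA_obj (ord_max : 'I_n.+2)
    = alternating_sum KZA_group
        (fun i : 'I_n.+1 => KZA_coef \oc face KZA_obj (widen_ord (leqnSn n.+1) i));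
  KZA_cosk : coskeletal n.+2 KZA_obj
}.

(* The isomorphism t 0 in degree -1, followed by KZA_base, is the
   identification of T_(-1) with Z. *)
Record is_torsor (Z A : C) (n : nat) (K : KZA Z A n) (T : asimp C) (t : smorph T K) :
    Prop := IsTorsor {
  torsor_base : is_iso (t 0);
  torsor_fibration : fibration t;
  torsor_exact : forall k, n <= k -> exact_in_degree t k;
  torsor_cosk : coskeletal n T;
  torsor_resolution : is_resolution T
}.

End Simplicial.

(* Main.v *)
Require Import Defs.
From mathcomp Require Import all_boot zify.
Set Implicit Arguments.
Unset Strict Implicit.
Unset Printing Implicit Defensive.

(** Exactness in degree n says that a horn of (n-1)-simplices of T over Z
    together with an element of A has a unique filler with that coefficient.
    If I switches between i-1 and i, say i-1 in I and i not in I, then for every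
    j <> i one of the j-th faces of s_i k and s_(i-1) l vanishes; taking the
    other one gives a horn on K x L, and the i-th face of its filler with
    coefficient 0 restricts to k and to l by uniqueness of fillers.  If I is
    empty, then (l, 0, ..., 0) bounds a unique n-simplex, and one fills the horn
    (d_j s_0 k)_(j > 0) with the coefficient of that simplex. *)

(** * Zero morphisms, limits and regular epimorphisms *)

Lemma exists_unique_eq (U : Type) (P : U -> Prop) (u v : U) :
  (exists! w, P w) -> P u -> P v -> u = v.
Proof. by case=> w [_ Hw] Pu Pv; rewrite -(Hw u Pu) -(Hw v Pv). Qed.

Lemma is_zero_compl (C : category) (X Y V : C) (g : hom Y V) (f : hom X Y) :
  is_zero f -> is_zero (g \oc f).
Proof.
case=> O [a [b [HO ->]]]; exists O, a, (g \oc b); split=> //.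
by rewrite Defs.compA.
Qed.

Lemma is_zero_compr (C : category) (X Y V : C) (g : hom Y V) (f : hom X Y) :
  is_zero g -> is_zero (g \oc f).
Proof.
case=> O [a [b [HO ->]]]; exists O, (a \oc f), b; split=> //.
by rewrite Defs.compA.
Qed.

Lemma is_zero_eq (C : category) (X Y : C) (f g : hom X Y) :
  is_zero f -> is_zero g -> f = g.
Proof.
case=> O [a [b [HO ->]]] [O' [a' [b' [HO' ->]]]].
(* The two zero objects may differ; [c] compares them. *)
have [c _] := HO.1 O'.
rewrite (exists_unique_eq (HO.1 X) I I : a = c \oc a') Defs.compA.
by rewrite (exists_unique_eq (HO'.2 Y) I I : b \oc c = b').
Qed.

Lemma zero_hom (C : category) (X Y : C) : pointed C ->
  exists f : hom X Y, is_zero f.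
Proof.
case=> O HO; have [a _] := HO.1 X; have [b _] := HO.2 Y.
by exists (b \oc a), O, a, b.
Qed.

Lemma regular_epi_cancel (C : category) (X Y V : C) (e : hom X Y) (f g : hom Y V) :
  regular_epi e -> f \oc e = g \oc e -> f = g.
Proof.
case=> R [d0 [d1 [E H]]] fg.
apply: (exists_unique_eq (H V (f \oc e) _)) => //.
by rewrite -!Defs.compA E.
Qed.

Lemma pullback_exists (C : category) (X Y B : C) (f : hom X B) (g : hom Y B) :
  finitely_complete C ->
  exists P (p : hom P X) (q : hom P Y), is_pullback f g p q.
Proof.
pose D := @Diagram C (option bool : finType) (bool : finType)
  (fun b => Some b) (fun _ => None)
  (fun v => match v with None => B | Some true => X | Some false => Y end)
  (fun e => match e with true => f | false => g end).
move=> /(_ D) [P [p [cp lp]]].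
exists P, (p (Some true)), (p (Some false)); split.
  by rewrite (cp true : f \oc _ = _) (cp false : g \oc _ = _).
move=> W x y fx.
pose q (v : vert D) : hom W (dob v) :=
  match v return hom W (@dob C D v) with
  | None => f \oc x | Some true => x | Some false => y end.
case: (lp W q) => [[]|u [Hu uu]] //; exists u; split.
  by split; [exact: (Hu (Some true)) | exact: (Hu (Some false))].
move=> v [vx vy]; apply: uu => -[[]|] //=.
by rewrite -(cp true : f \oc _ = _) /= -Defs.compA vx.
Qed.

Lemma product_exists (C : category) (X Y : C) :
  pointed C -> finitely_complete C ->
  exists P (p : hom P X) (q : hom P Y), is_product p q.
Proof.
(* A product is a pullback over a zero object. *)
move=> [O HO] fc; have [a _] := HO.1 X; have [b _] := HO.1 Y.
have [P [p [q [_ H]]]] := pullback_exists a b fc.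
exists P, p, q => W x y; apply: H; exact: (exists_unique_eq (HO.1 W) I I).
Qed.

(** Pulling [f] back along [w] gives a cover [e] of [W] over which [w] has a preimage: regular
    epimorphisms are locally surjective on generalised elements. *)
Lemma regular_epi_lift (C : category) (X Y W : C) (f : hom X Y) (w : hom W Y) :
  regular_category C -> regular_epi f ->
  exists V (e : hom V W) (v : hom V X), regular_epi e /\ f \oc v = w \oc e.
Proof.
move=> [fc _ st] rf; have [V [v [e pb]]] := pullback_exists f w fc.
by exists V, e, v; split; [exact: st pb rf | exact: pb.1].
Qed.

(** * Huq commutation *)

Lemma Huq_commute_sym (C : category) (K L X : C) (k : hom K X) (l : hom L X) :
  Huq_commute k l -> Huq_commute l k.
Proof.
move=> [P [p [q [i [j [phi [Hp [pi qi] [pj qj] [fi fj]]]]]]]].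
exists P, q, p, j, i, phi; split=> // W x y.
case: (Hp W y x) => u [[pu qu] Hu]; exists u; split=> // v [? ?].
exact: Hu.
Qed.

(** The zero subobject is the kernel of [idm X], which is also its cokernel, so commuting modulo
    zero is plain commuting; and zero lies below every subobject. *)
Lemma Huq_commute_trivial (C : category) (K L X : C) (k : hom K X) (l : hom L X) :
  pointed C -> Huq_commute k l -> Huq_commutator_trivial k l.
Proof.
move=> [O HO] kl; have [o _] := HO.2 X; have [a _] := HO.1 X.
have zo : is_zero o by exists O, (idm O), o; split=> //; rewrite compm1.
exists O, o; split=> //; split.
- exists X, (idm X); split; first by rewrite comp1m.
  move=> W w; rewrite comp1m => zw; have [c _] := HO.1 W; exists c; split.
    exact: is_zero_eq (is_zero_compr _ zo) zw.
  by move=> c' _; apply: exists_unique_eq (HO.1 W) I I.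
- exists X, (idm X); rewrite !comp1m; split=> //; split; first by rewrite comp1m.
  by move=> W w _; exists w; split; [exact: compm1 | move=> w'; rewrite compm1].
- move=> N' c' _ _; have [b _] := HO.2 N'; exists b.
  exact: (exists_unique_eq (HO.2 X) I I).
Qed.

(** * Simplicial identities *)

Lemma delta_empty_eq n (f g : delta 0 n) : f = g.
Proof. by apply: delta_ext => -[]. Qed.

Lemma smap_augmentation (C : category) (X : asimp C) m n (f : delta m n) :
  augmentation X m \oc smap X f = augmentation X n.
Proof. by rewrite /augmentation -smap_comp (delta_empty_eq (delta_comp _ _) (delta_empty n)). Qed.

Lemma augmentation_nat (C : category) (X Y : asimp C) (t : smorph X Y) n :
  augmentation Y n \oc t n = t 0 \oc augmentation X n.
Proof. exact: scomp_nat. Qed.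

Lemma augmentation_zero (C : category) (X : asimp C) n (i : 'I_n) W (x : hom W (X n)) :
  is_zero (face X i \oc x) -> is_zero (augmentation X n \oc x).
Proof. by move=> z; rewrite -(smap_augmentation X (coface i)) -Defs.compA; apply: is_zero_compl. Qed.

Lemma delta_compE m n p (g : delta n p) (f : delta m n) x :
  delta_comp g f x = g (f x).
Proof. exact: mkdeltaE. Qed.

Lemma cofaceE n (i : 'I_n) x : coface i x = bump i x :> nat.
Proof. by rewrite mkdeltaE. Qed.

Lemma codegenE n (i : 'I_n) x : codegen i x = unbump i x :> nat.
Proof. by rewrite mkdeltaE. Qed.

Lemma face_simplicial_equation (C : category) (X : asimp C) m W (u : hom W (X m.+2))
    (i j : 'I_m.+2) :
  simplicial_equation (fun j => face X j \oc u) i j.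
Proof.
move=> ij; rewrite !Defs.compA; congr (_ \oc _); rewrite /face -!smap_comp.
congr (smap X _); apply: delta_ext => x; apply: ord_inj.
rewrite !delta_compE !cofaceE.
have := ltn_ord j; have := ltn_ord i; have := ltn_ord x => /= xm im jm.
rewrite !inordK /bump; lia.
Qed.

Lemma face_degen_id (C : category) (X : asimp C) n (i : 'I_n) (j : 'I_n.+1) :
  (j == i :> nat) || (j == i.+1 :> nat) -> face X j \oc degen X i = idm (X n).
Proof.
move=> ij; rewrite /face /degen -smap_comp -smap_id; congr (smap X _).
apply: delta_ext => x; apply: ord_inj.
rewrite !delta_compE !(cofaceE, codegenE) ?ffunE /= /bump /unbump; lia.
Qed.

(** The identity is d_j s_i = s_(i-1) d_j. The degeneracy stays existential: what matters later is
    that the composite vanishes on whatever [face X j'] kills. *)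
Lemma face_degen_lt (C : category) (X : asimp C) m (i : 'I_m.+1) (j : 'I_m.+2)
    (j' : 'I_m.+1) : j < i -> j = j' :> nat ->
  exists d : hom (X m) (X m.+1), face X j \oc degen X i = d \oc face X j'.
Proof.
move=> ij jj; have im := ltn_ord i.
have i1 : i.-1 < m by lia.
exists (degen X (Ordinal i1)); rewrite /face /degen -!smap_comp; congr (smap X _).
apply: delta_ext => x; apply: ord_inj.
rewrite !delta_compE !(cofaceE, codegenE) ?ffunE /= /bump /unbump; lia.
Qed.

(** The companion identity d_j s_i = s_i d_(j-1), beyond the two faces that cancel [degen X i]. *)
Lemma face_degen_gt (C : category) (X : asimp C) m (i : 'I_m.+1) (j : 'I_m.+2)
    (j' : 'I_m.+1) : i.+1 < j -> j = j'.+1 :> nat ->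
  exists d : hom (X m) (X m.+1), face X j \oc degen X i = d \oc face X j'.
Proof.
move=> ij jj; have jm := ltn_ord j.
have i1 : i < m by lia.
exists (degen X (Ordinal i1)); rewrite /face /degen -!smap_comp; congr (smap X _).
apply: delta_ext => x; apply: ord_inj.
rewrite !delta_compE !(cofaceE, codegenE) ?ffunE /= /bump /unbump; lia.
Qed.

(** * Horn fillers and elements of K(Z,A,n) *)

(** The pullback [P] classifies pairs of a horn in [X] and a compatible simplex of [Y]; since the
    comparison [c] is invertible, such a pair amounts to one simplex of [X]. *)
Lemma horn_filler (C : category) (X Y : asimp C) (f : smorph X Y) m (i : 'I_m.+2) :
  exact_in_degree f m.+1 ->
  forall W (x : horn_index i -> hom W (X m.+1)) (y : hom W (Y m.+2)),
    horn_equations x -> (forall j, f m.+1 \oc x j = face Y (val j) \oc y) ->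
  exists! u : hom W (X m.+2),
    (forall j, face X (val j) \oc u = x j) /\ f m.+2 \oc u = y.
Proof.
move=> /(_ m i erefl) [P [c [[HX [p [HY [q [fH [h [a [b]]]]]]]]]]].
move=> [[[pe pu] [qe qu]] qf qh [ab pb] [pac bc]] [d [dc cd]] W x y xe xy.
have [w [wx wu]] := pu W x xe.
have E : fH \oc w = h \oc y.
  have He : horn_equations (fun j => q j \oc (h \oc y)).
    by move=> j j' jj; rewrite !Defs.compA qe.
  apply: (exists_unique_eq (qu W _ He)) => // j.
  by rewrite !Defs.compA qf qh -Defs.compA wx xy.
have [v [[av bv] vu]] := pb W w y E.
exists (d \oc v); split.
  split; last by rewrite -bc -!Defs.compA (Defs.compA c) cd comp1m.
  by move=> j; rewrite -pac -!Defs.compA (Defs.compA c) cd comp1m av wx.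
move=> u [ux fu].
have -> : v = c \oc u.
  apply: vu; split; last by rewrite Defs.compA bc.
  by symmetry; apply: wu => j; rewrite -ux -pac !Defs.compA.
by rewrite Defs.compA dc comp1m.
Qed.

Lemma KZA_low_eq (C : category) (Z A : C) n (K : KZA Z A n) m W (x y : hom W (K m)) :
  m <= n -> augmentation K m \oc x = augmentation K m \oc y -> x = y.
Proof.
move=> mn E; have [g [ga _]] := KZA_low K mn.
by rewrite -(comp1m x) -(comp1m y) -ga -!Defs.compA E.
Qed.

Lemma KZA_top_eq (C : category) (Z A : C) n (K : KZA Z A n) W (x y : hom W (K n.+1)) :
  KZA_coef K \oc x = KZA_coef K \oc y ->
  augmentation K n.+1 \oc x = augmentation K n.+1 \oc y -> x = y.
Proof.
move=> cE aE; apply: (exists_unique_eq (KZA_top K (KZA_coef K \oc y)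
  (KZA_base K \oc augmentation K n.+1 \oc y))); split=> //.
by rewrite -!Defs.compA aE.
Qed.

Lemma KZA_top_pair (C : category) (Z A : C) n (K : KZA Z A n) W
    (x : hom W A) (z : hom W (K 0)) :
  exists y : hom W (K n.+1),
    KZA_coef K \oc y = x /\ augmentation K n.+1 \oc y = z.
Proof.
have [y [[yx yz] _]] := KZA_top K x (KZA_base K \oc z).
have [g [gb _]] := KZA_base_iso K.
exists y; split=> //.
by rewrite -(comp1m (_ \oc y)) -gb -Defs.compA (Defs.compA (KZA_base K)) yz Defs.compA gb comp1m.
Qed.

(* An element of degree n + 1 is determined by its faces except the last,
   because the last face is the alternating sum of the others. *)
Lemma KZA_next_eq (C : category) (Z A : C) n (K : KZA Z A n) W (x y : hom W (K n.+2)) :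
  (forall j : 'I_n.+2, j != ord_max -> face K j \oc x = face K j \oc y) -> x = y.
Proof.
move=> E; apply: (exists_unique_eq (KZA_next K
  (fun i => KZA_coef K \oc face K (widen_ord (leqnSn n.+1) i) \oc y)
  (KZA_base K \oc augmentation K n.+2 \oc y))); split=> //.
  move=> i; rewrite -!Defs.compA E // -val_eqE /=.
  by have := ltn_ord i; lia.
have H : (ord0 : 'I_n.+2) != ord_max by rewrite -val_eqE.
rewrite -!Defs.compA -(smap_augmentation K (coface (ord0 : 'I_n.+2))) -!Defs.compA.
by rewrite (E ord0 H : smap K _ \oc _ = _).
Qed.

(** * Boundaries and horns in a torsor *)

(* Replacing the last face of s_n u by v gives a boundary, filled by T3 after a
   regular epimorphism; exactness in degree n + 1 forces the filler to be s_n u,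
   since both restrict to the same horn. *)
Lemma torsor_faces_jointly_monic (C : category) (Z A : C) m
    (K : KZA Z A m.+1) (T : asimp C) (t : smorph T K) W (u v : hom W (T m.+2)) :
  regular_category C -> is_torsor t ->
  (forall j : 'I_m.+2, face T j \oc u = face T j \oc v) -> u = v.
Proof.
move=> hC hT uv.
have [D [p [c [[pe pu] pc rc]]]] := (torsor_resolution hT).2 m.+1.
pose s := degen T (ord_max : 'I_m.+2) \oc u.
pose x (j : 'I_m.+3) := if j == ord_max then v else face T j \oc s.
have su : face T (ord_max : 'I_m.+3) \oc s = u.
  by rewrite Defs.compA face_degen_id ?comp1m //= eqxx orbT.
have xe i j : simplicial_equation x i j.
  move=> ij; have im : i != ord_max by rewrite -val_eqE /=; have := ltn_ord j; lia.
  rewrite /x (negbTE im); case: eqP => [Ej|_]; last exact: face_simplicial_equation.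
  by rewrite -uv -[in LHS]su -{1}Ej; exact: face_simplicial_equation.
have [w [wx _]] := pu W x xe.
have [V [e [r [re cr]]]] := regular_epi_lift w hC rc.
have rx j : face T j \oc r = x j \oc e by rewrite -pc -Defs.compA cr Defs.compA wx.
have xs j : j != ord_max -> x j = face T j \oc s by rewrite /x => /negbTE ->.
have Er : r = s \oc e.
  have ex : exact_in_degree t m.+2 by apply: (torsor_exact hT).
  pose xr (j : horn_index (ord_max : 'I_m.+3)) := face T (val j) \oc r.
  have re' : horn_equations xr by move=> a b; exact: face_simplicial_equation.
  have tr j : t m.+2 \oc xr j = face K (val j) \oc (t m.+3 \oc r).
    by rewrite /xr !Defs.compA /face scomp_nat.
  apply: (exists_unique_eq (horn_filler ex re' tr)) => //; split.
    by move=> [j jm]; rewrite /xr /= rx xs ?Defs.compA.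
  (* The images in [K] are determined by the very faces that form the horn. *)
  apply: KZA_next_eq => j jm.
  rewrite !Defs.compA /face !scomp_nat -!Defs.compA.
  by rewrite [in RHS](rx j : smap T _ \oc r = _) xs // !Defs.compA.
apply: (regular_epi_cancel re).
by rewrite -{1}su -Defs.compA -Er rx /x eqxx.
Qed.

(** (T3) fills the boundary only over a regular epimorphism [e]. As n-simplices are determined by
    their faces, this filler coequalises the pair of which [e] is the coequaliser, and so descends
    along [e]. *)
Lemma torsor_face_lift (C : category) (Z A : C) m
    (K : KZA Z A m.+1) (T : asimp C) (t : smorph T K)
    W (x : 'I_m.+2 -> hom W (T m.+1)) :
  regular_category C -> is_torsor t ->
  (forall i j, simplicial_equation x i j) ->
  exists u : hom W (T m.+2), forall j, face T j \oc u = x j.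
Proof.
move=> hC hT xe.
have [D [p [c [[pe pu] pc rc]]]] := (torsor_resolution hT).2 m.
have [w [wx _]] := pu W x xe.
have [V [e [r [re cr]]]] := regular_epi_lift w hC rc.
have rx j : face T j \oc r = x j \oc e by rewrite -pc -Defs.compA cr Defs.compA wx.
have re2 := re; have [R [d0 [d1 [ed eu]]]] := re2.
have rd : r \oc d0 = r \oc d1.
  apply: (torsor_faces_jointly_monic hC hT) => j.
  by rewrite !Defs.compA rx -!Defs.compA ed.
have [u [ue _]] := eu _ r rd.
exists u => j; apply: (regular_epi_cancel re).
by rewrite -Defs.compA ue rx.
Qed.

(* The horn whose entries come from [al] or [be], whichever is nonzero, is
   filled in such a way that the filler restricts to [al] on K and to [be] on L;
   its [i]-th face is then the required morphism K x L -> T_(n-1). *)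
Lemma torsor_faces_commute (C : category) (Z A : C) m
    (K : KZA Z A m.+1) (T : asimp C) (t : smorph T K)
    (M L : C) (al : hom M (T m.+2)) (be : hom L (T m.+2))
    (i : 'I_m.+2) (b : 'I_m.+2 -> bool) :
  pointed C -> finitely_complete C -> is_torsor t ->
  (forall j, j != i ->
     if b j then is_zero (face T j \oc al) else is_zero (face T j \oc be)) ->
  is_zero (augmentation T m.+2 \oc be) ->
  is_zero (KZA_coef K \oc (t m.+2 \oc al)) ->
  Huq_commute (face T i \oc al) (face T i \oc be).
Proof.
move=> hp fc hT ab zbe zal.
have [P [p [q pq]]] := product_exists M L hp fc.
have [zML zMLz] := zero_hom M L hp; have [zLM zLMz] := zero_hom L M hp.
have [iM [[piM qiM] _]] := pq _ (idm M) zML.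
have [jL [[pjL qjL] _]] := pq _ zLM (idm L).
have zqi : is_zero (q \oc iM) by rewrite qiM.
have zpj : is_zero (p \oc jL) by rewrite pjL.
(* [b j] records which [j]-th face is known to vanish; the entry comes from the other simplex. *)
pose x (j : horn_index i) : hom P (T m.+1) :=
  if b (val j) then face T (val j) \oc (be \oc q) else face T (val j) \oc (al \oc p).
have xM j : x j \oc iM = face T (val j) \oc al.
  case: j => j ji; rewrite /x /=; have := ab j ji; case: (b j) => zj.
    apply: is_zero_eq zj; rewrite -!Defs.compA.
    by do 2 apply: is_zero_compl.
  by rewrite -!Defs.compA piM compm1.
have xL j : x j \oc jL = face T (val j) \oc be.
  case: j => j ji; rewrite /x /=; have := ab j ji; case: (b j) => zj.
    by rewrite -!Defs.compA qjL compm1.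
  apply: is_zero_eq zj; rewrite -!Defs.compA.
  by do 2 apply: is_zero_compl.
have xe : horn_equations x.
  have zero_al j : j != i -> b j -> is_zero (face T j \oc al).
    by move=> ji bj; have := ab j ji; rewrite bj.
  have zero_be j : j != i -> b j = false -> is_zero (face T j \oc be).
    by move=> ji bj; have := ab j ji; rewrite bj.
  move=> [j ji] [j' ji']; rewrite /x /= => jj.
  have Eal : _ = _ := face_simplicial_equation (al \oc p) jj.
  have Ebe : _ = _ := face_simplicial_equation (be \oc q) jj.
  (* When the two entries come from different simplices, the simplicial identity brings the
     vanishing face next to [al] or [be], so both sides are zero. *)
  case bj : (b j); case bj' : (b j') => //.
  - apply: is_zero_eq.
      rewrite Eal !Defs.compA -(Defs.compA _ (face T j)).
      by apply/is_zero_compr/is_zero_compl/zero_al.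
    rewrite -Ebe !Defs.compA -(Defs.compA _ (face T j')).
    by apply/is_zero_compr/is_zero_compl/zero_be.
  - apply: is_zero_eq.
      rewrite Ebe !Defs.compA -(Defs.compA _ (face T j)).
      by apply/is_zero_compr/is_zero_compl/zero_be.
    rewrite -Eal !Defs.compA -(Defs.compA _ (face T j')).
    by apply/is_zero_compr/is_zero_compl/zero_al.
(* The coefficient is taken from [be] and the base point from [al]: since [al] has coefficient zero
   and [be] has zero augmentation, [y] restricts to the images of both. *)
have [y [ycoef yaug]] := KZA_top_pair (K := K)
  (KZA_coef K \oc (t m.+2 \oc (be \oc q))) (t 0 \oc (augmentation T m.+2 \oc (al \oc p))).
have aug_face j V (w : hom V (T m.+2)) :
    augmentation T m.+1 \oc (face T j \oc w) = augmentation T m.+2 \oc w.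
  by rewrite Defs.compA (smap_augmentation T (coface j)).
have ty j : t m.+1 \oc x j = face K (val j) \oc y.
  (* In degree n-1 the object [K] is a copy of Z, so comparing augmentations suffices. *)
  apply: KZA_low_eq => //.
  rewrite (Defs.compA _ (face K (val j))) (smap_augmentation K (coface (val j))) yaug.
  rewrite Defs.compA augmentation_nat -Defs.compA; congr (_ \oc _).
  case: j => j ji; rewrite /x /=; have := ab j ji; case: (b j) => zj; rewrite aug_face //.
  apply: is_zero_eq; rewrite Defs.compA; first exact: is_zero_compr.
  apply: is_zero_compr; exact: augmentation_zero zj.
have ex : exact_in_degree t m.+1 by apply: (torsor_exact hT).
have [u [[ux tu] _]] := horn_filler ex xe ty.
(* Any simplex [w] is the unique filler of its own horn with its own image in [K]. *)
have filler_eq V (f : hom V P) (w : hom V (T m.+2)) :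
    (forall j, x j \oc f = face T (val j) \oc w) -> y \oc f = t m.+2 \oc w ->
    u \oc f = w.
  move=> xf yf.
  pose xw (j : horn_index i) := face T (val j) \oc w.
  have we : horn_equations xw by move=> j j'; exact: face_simplicial_equation.
  have tw j : t m.+1 \oc xw j = face K (val j) \oc (t m.+2 \oc w).
    by rewrite /xw !Defs.compA /face scomp_nat.
  apply: (exists_unique_eq (horn_filler ex we tw)) => //; split.
    by move=> j; rewrite Defs.compA ux xf.
  by rewrite Defs.compA tu yf.
exists P, p, q, iM, jL, (face T i \oc u); split=> //.
(* What remains are the coefficient and the augmentation of [y], first on [M] and then on [L]. *)
split; rewrite -Defs.compA; congr (_ \oc _); apply: filler_eq => //; apply: KZA_top_eq.
- apply: is_zero_eq zal.
  by rewrite Defs.compA ycoef -!Defs.compA; do 3 apply: is_zero_compl.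
- by rewrite Defs.compA yaug (Defs.compA _ (t _)) augmentation_nat -!Defs.compA piM compm1.
- by rewrite Defs.compA ycoef -!Defs.compA qjL compm1.
- rewrite Defs.compA yaug (Defs.compA _ (t _)) augmentation_nat -!Defs.compA.
  by apply: is_zero_eq; apply: is_zero_compl => //; do 2 apply: is_zero_compl.
Qed.

(** * The cases for I *)

Lemma degen_coef_zero (C : category) (Z A : C) n
    (K : KZA Z A n) (T : asimp C) (t : smorph T K) (i : 'I_n) W (w : hom W (T n)) :
  is_zero (KZA_coef K \oc (t n.+1 \oc (degen T i \oc w))).
Proof.
rewrite (Defs.compA (t _)) /degen -scomp_nat !Defs.compA.
by do 2 apply: is_zero_compr; exact: KZA_degen.
Qed.

Lemma torsor_commute_all_kernels (C : category) (Z A : C) m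
    (K : KZA Z A m.+1) (T : asimp C) (t : smorph T K)
    (M L : C) (k : hom M (T m.+1)) (l : hom L (T m.+1)) :
  pointed C -> regular_category C -> is_torsor t ->
  (forall i : 'I_m.+1, is_zero (face T i \oc l)) -> Huq_commute k l.
Proof.
move=> hp hC hT zl; have [o zo] := zero_hom L (T m.+1) hp.
pose x (j : 'I_m.+2) := if j == ord0 then l else o.
have zx (i : 'I_m.+1) j : is_zero (face T i \oc x j).
  by rewrite /x; case: eqP => _ //; apply: is_zero_compl.
have [u ux] : exists u : hom L (T m.+2), forall j, face T j \oc u = x j.
  (* Both sides of every simplicial equation are zero. *)
  by apply: (torsor_face_lift hC hT) => i j _; apply: is_zero_eq.
have -> : k = face T (ord0 : 'I_m.+2) \oc (degen T (ord0 : 'I_m.+1) \oc k).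
  by rewrite Defs.compA face_degen_id ?comp1m.
have -> : l = face T (ord0 : 'I_m.+2) \oc u by rewrite ux /x eqxx.
have [fc _ _] := hC.
have zu j : j != ord0 -> is_zero (face T j \oc u).
  by move=> j0; rewrite ux /x (negbTE j0).
(* All faces of [u] but the zeroth vanish, so the whole horn is taken from the degeneracy of [k]. *)
apply: (torsor_faces_commute (b := fun _ => false) hp fc hT) => //.
- have H : (ord_max : 'I_m.+2) != ord0 by rewrite -val_eqE.
  exact: augmentation_zero (zu _ H).
- exact: degen_coef_zero.
Qed.

Lemma torsor_commute_switch (C : category) (Z A : C) m
    (K : KZA Z A m.+1) (T : asimp C) (t : smorph T K) (I : {set 'I_m.+1})
    (M L : C) (k : hom M (T m.+1)) (l : hom L (T m.+1)) (a i : 'I_m.+1) :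
  pointed C -> finitely_complete C -> is_torsor t ->
  (forall j, j \in I -> is_zero (face T j \oc k)) ->
  (forall j, j \notin I -> is_zero (face T j \oc l)) ->
  i = a.+1 :> nat -> a \in I -> i \notin I -> Huq_commute k l.
Proof.
move=> hp fc hT zk zl ia aI iI.
pose i' : 'I_m.+2 := widen_ord (leqnSn _) i.
have -> : k = face T i' \oc (degen T i \oc k).
  by rewrite Defs.compA face_degen_id ?comp1m //= eqxx.
have -> : l = face T i' \oc (degen T a \oc l).
  by rewrite Defs.compA face_degen_id ?comp1m //= ia eqxx orbT.
(* For [j] below [i] the [j]-th face of either degeneracy factors through face [j] of [k] or [l],
   above [i] through face j-1; hence [unbump]. The exceptions, where the degeneracy cancels, are j =
   i+1 for [k] and j = a for [l]; there the other simplex has the vanishing face, as [i] is outside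
   [I] and [a] inside. *)
apply: (torsor_faces_commute (b := fun j => inord (unbump i j) \in I) hp fc hT).
- move=> j; rewrite -val_eqE /= => ji.
  have jm := ltn_ord j; have im := ltn_ord i; rewrite /unbump.
  case: (ltnP i j) => ij /=.
    have jE : j = (inord (j - 1) : 'I_m.+1).+1 :> nat by rewrite inordK; lia.
    case: ifPn => HI.
      have ij1 : i.+1 < j.
        rewrite ltnNge; apply/negP => ji1; move: iI.
        have -> : i = inord (j - 1) :> 'I_m.+1 by apply: val_inj => /=; lia.
        by rewrite HI.
      have [d dE] := face_degen_gt T ij1 jE.
      by rewrite Defs.compA dE -Defs.compA; apply/is_zero_compl/zk.
    have aj : a.+1 < j by lia.
    have [d dE] := face_degen_gt T aj jE.
    by rewrite Defs.compA dE -Defs.compA; apply/is_zero_compl/zl.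
  have jE : j = (inord (j - 0) : 'I_m.+1) :> nat by rewrite inordK; lia.
  case: ifPn => HI.
    have ji1 : j < i by lia.
    have [d dE] := face_degen_lt T ji1 jE.
    by rewrite Defs.compA dE -Defs.compA; apply/is_zero_compl/zk.
  have ja : j < a.
    rewrite ltnNge; apply/negP => aj; move: HI.
    have <- : a = inord (j - 0) :> 'I_m.+1 by apply: val_inj => /=; lia.
    by rewrite aI.
  have [d dE] := face_degen_lt T ja jE.
  by rewrite Defs.compA dE -Defs.compA; apply/is_zero_compl/zl.
(* A degeneracy preserves the augmentation, and the [i]-th face of [l] is zero. *)
- rewrite Defs.compA (smap_augmentation T (codegen a)).
  exact: augmentation_zero (zl _ iI).
- exact: degen_coef_zero.
Qed.

Lemma set_ord_constant_or_switch m (I : {set 'I_m.+1}) :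
  [\/ I = set0, I = setT
    | exists a i : 'I_m.+1, i = a.+1 :> nat /\ (a \in I) != (i \in I)].
Proof.
case: (boolP [exists a : 'I_m.+1, exists i : 'I_m.+1,
    (i == a.+1 :> nat) && ((a \in I) != (i \in I))]) => [|no].
  move=> /existsP [a /existsP [i /andP [/eqP ia aI]]].
  by apply: Or33; exists a, i.
(* Without a switch between neighbours, membership propagates from 0 by induction. *)
have const k (km : k < m.+1) : (Ordinal km \in I) = (ord0 \in I).
  elim: k km => [|k IH] km.
    by congr (_ \in I); apply: val_inj.
  have km' := ltnW km; rewrite -(IH km'); apply/eqP/negPn/negP => ne.
  move/existsP: no; apply; exists (Ordinal km'); apply/existsP; exists (Ordinal km).
  by rewrite eqxx /= eq_sym.
case H : (ord0 \in I); [apply: Or32 | apply: Or31];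
  by apply/setP => -[k km]; rewrite const H inE.
Qed.

Lemma subobject_kernel_zero (C : category) (X Y M K : C) (f : hom X Y)
    (m : hom M X) (k : hom K X) :
  is_kernel f m -> subobject_le k m -> is_zero (f \oc k).
Proof. by move=> [z _] [u ->]; rewrite Defs.compA; apply: is_zero_compr. Qed.

Theorem proposition5p8 (C : category) (hC : semi_abelian C)
    (n : nat) (hn : 0 < n) (Z A : C) (hA : abelian A)
    (K : KZA Z A n) (T : asimp C) (t : smorph T K) (hT : is_torsor t) :
  H_central (fun i : 'I_n => face T i).
Proof.
have [hp [hreg _] _ _] := hC; have [fc _ _] := hreg.
case: n hn K t hT => // m _ K t hT M mm km I N k L l [kI _] [lI _].
have zk j : j \in I -> is_zero (face T j \oc k).
  by move=> /kI; apply: subobject_kernel_zero.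
have zl j : j \notin I -> is_zero (face T j \oc l).
  by rewrite -in_setC => /lI; apply: subobject_kernel_zero.
apply: Huq_commute_trivial => //.
have [I0|IT|[a [i [ia]]]] := set_ord_constant_or_switch I.
- apply: (torsor_commute_all_kernels _ hp hreg hT) => j.
  by apply: zl; rewrite I0 inE.
- apply/Huq_commute_sym/(torsor_commute_all_kernels _ hp hreg hT) => j.
  by apply: zk; rewrite IT inE.
case aI : (a \in I); case iI : (i \in I) => // _.
  by apply: (torsor_commute_switch hp fc hT zk zl ia); rewrite ?iI.
(* A switch in the other direction becomes the previous one on exchanging [k] with [l] and [I] with
   its complement. *)
apply: Huq_commute_sym.
apply: (torsor_commute_switch (I := ~: I) hp fc hT _ _ ia); rewrite ?inE ?aI ?iI //.
  by move=> j; rewrite inE => /zl.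
by move=> j; rewrite inE negbK => /zk.
Qed.
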